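(* Let $d\ge 2$, let $\mathcal{S}_0\subset\mathbb{R}^d$ be the region being partitioned, and let $(\mathcal{S}_k)_{k\ge 0}$ be the simplicial partitions of this region obtained during partitioning (the initial partition being denoted by the same symbol $\mathcal{S}_0$ as the region). Suppose that there is a constant $\eta>0$ such that every simplex $S$ belonging to any of the partitions $\mathcal{S}_k$, $k\ge 0$, satisfies $$\operatorname{vol}(S)\ \ge\ \eta\, h(S)^d .$$ Then for every point $\gamma_0$ of the region $\mathcal{S}_0$ and every $k\ge 0$, the number of simplices $S\in\mathcal{S}_k$ with $\gamma_0\in S$ is at most $$\frac{1}{\eta}\left(\frac{2e\pi}{d}\right)^{\frac d2}.$$
   Context: A simplicial partition of a region in $\mathbb{R}^d$ is a finite collection of closed nondegenerate $d$-dimensional simplices whose union is the region and whose interiors are pairwise disjoint. For a $d$-simplex $S\subset\mathbb{R}^d$, $\operatorname{vol}(S)$ denotes its $d$-dimensional volume (Lebesgue measure) and $h(S)$ denotes the length (Euclidean norm) of its longest edge. Here $e$ is the base of the natural logarithm. The constant $\eta$ is the same for all simplices of all the partitions. *)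

(* Defs.v *)
From HB Require Import structures.
From mathcomp Require Import all_boot all_order all_algebra.
From mathcomp Require Import all_classical all_reals all_analysis.

Set Implicit Arguments.
Unset Strict Implicit.
Unset Printing Implicit Defensive.
Import Order.TTheory GRing.Theory Num.Theory.
Import numFieldNormedType.Exports.
Local Open Scope classical_set_scope.
Local Open Scope ring_scope.

Section LebesgueMeasure.
Context {R : realType}.
Local Notation RT := (measurableTypeR R).

Definition consT n (p : RT * n.-tuple RT) : n.+1.-tuple RT :=
  [the n.+1.-tuple RT of p.1 :: p.2].

Lemma measurable_consT n : measurable_fun [set: RT * n.-tuple RT] (@consT n).
Proof. exact: measurable_cons measurable_fst measurable_snd. Qed.

HB.instance Definition _ n :=
  isMeasurableFun.Build _ _ _ _ (@consT n) (@measurable_consT n).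

Section Step.
Variables (n : nat) (mu : {sigma_finite_measure set (n.-tuple RT) -> \bar R}).

Definition lebesgue_step : set (n.+1.-tuple RT) -> \bar R :=
  pushforward (lebesgue_measure \x mu)%E (@consT n).

Let lebesgue_step0 : lebesgue_step set0 = 0%E.
Proof. exact: measure0. Qed.

Let lebesgue_step_ge0 A : (0 <= lebesgue_step A)%E.
Proof. exact: measure_ge0. Qed.

Let lebesgue_step_sigma_additive : semi_sigma_additive lebesgue_step.
Proof. exact: measure_semi_sigma_additive. Qed.

HB.instance Definition _ := isMeasure.Build _ _ _ lebesgue_step
  lebesgue_step0 lebesgue_step_ge0 lebesgue_step_sigma_additive.

Lemma lebesgue_step_sigma_finite : sigma_finite setT lebesgue_step.
Proof.
have /sigma_finiteP[F [FT ndF Foo]] := sigma_finiteT (@lebesgue_measure R).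
have /sigma_finiteP[G [GT ndG Goo]] := sigma_finiteT mu.
pose tail (t : n.+1.-tuple RT) := [tuple of behead t].
exists (fun k => (fun t => thead t) @^-1` F k `&` tail @^-1` G k).
  apply/esym; rewrite -subTset => t _.
  have [i _ Fi] : (\bigcup_i F i) (thead t) by rewrite -FT.
  have [j _ Gj] : (\bigcup_i G i) (tail t) by rewrite -GT.
  exists (maxn i j) => //; split => /=.
    by move: Fi; exact/subsetPset/ndF/leq_maxl.
  by move: Gj; exact/subsetPset/ndG/leq_maxr.
move=> k; have [mF Fk] := Foo k; have [mG Gk] := Goo k; split.
  apply: measurableI; rewrite -[X in measurable X]setTI.
    exact: (measurable_tnth ord0).
  exact: measurable_behead.
rewrite /lebesgue_step /pushforward.
rewrite (_ : _ @^-1` _ = F k `*` G k); last first.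
  apply/seteqP; split=> -[x t] [] /=; rewrite theadE.
    by move=> Fx; rewrite (_ : tail _ = t)//; exact: val_inj.
  by move=> Fx; rewrite (_ : tail _ = t)//; exact: val_inj.
by rewrite product_measure1E// lte_mul_pinfty// ge0_fin_numE.
Qed.

HB.instance Definition _ := Measure_isSigmaFinite.Build _ _ _
  lebesgue_step lebesgue_step_sigma_finite.

End Step.

(* The n-fold product of the one-dimensional Lebesgue measure, i.e. the Lebesgue
   measure on the Borel sets of R^n, with R^n carried by n-tuples because the
   library gives them their product sigma-algebra. *)
Fixpoint lebesgue_tuple n : {sigma_finite_measure set (n.-tuple RT) -> \bar R} :=
  match n with
  | 0 => \d_([tuple] : 0.-tuple RT)
  | n'.+1 => lebesgue_step (lebesgue_tuple n')
  end.

Lemma lebesgue_tuple_box n (A : 'I_n -> set RT) :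
  (forall i, measurable (A i)) ->
  lebesgue_tuple n [set t | forall i, A i (tnth t i)] =
  (\prod_(i < n) lebesgue_measure (A i))%E.
Proof.
elim: n A => [|n IH] A mA.
  rewrite big_ord0 /= diracE mem_set//= => -[].
  by [].
rewrite big_ord_recl -IH// /= /lebesgue_step /pushforward.
rewrite -product_measure1E//; last first.
  rewrite (_ : mkset _ =
      \bigcap_(i in [set: 'I_n]) ((@tnth n RT)^~ i @^-1` A (lift ord0 i))).
    apply: fin_bigcap_measurable => // i _; rewrite -[X in measurable X]setTI.
    exact: measurable_tnth.
  by apply/seteqP; split=> [t At i _|t At i]; exact: At.
congr (_ _); apply/seteqP; split=> -[x t] /=.
  move=> At; split=> [|i]; first exact: (At ord0).
  by have := At (lift ord0 i); rewrite tnthS.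
case=> Ax At i; have [j ->|->//] := unliftP ord0 i.
by rewrite tnthS; exact: At.
Qed.

End LebesgueMeasure.

(* Meaningful on Borel sets only; simplices are compact, hence Borel. *)
Definition volume (R : realType) (d : nat) (A : set 'rV[R]_d) : \bar R :=
  lebesgue_tuple d [set t | A (\row_i tnth t i)].

(* The library norm on 'rV[R]_d is the sup norm. *)
Definition euclidean_norm (R : realType) (d : nat) (x : 'rV[R]_d) : R :=
  Num.sqrt (\sum_(i < d) x 0 i ^+ 2).

Definition affinely_independent (R : realType) (d n : nat)
    (v : 'I_n.+1 -> 'rV[R]_d) : bool :=
  row_free (\matrix_(i < n) (v (lift ord0 i) - v ord0)).

Record simplex (R : realType) (d : nat) := Simplex {
  vertex : 'I_d.+1 -> 'rV[R]_d;
  vertex_affinely_independent : affinely_independent vertex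
}.

Definition body (R : realType) (d : nat) (S : simplex R d) : set 'rV[R]_d :=
  [set x | exists a : 'I_d.+1 -> R,
     [/\ forall i, 0 <= a i, \sum_i a i = 1
       & x = \sum_i a i *: vertex S i]].

Definition longest_edge (R : realType) (d : nat) (S : simplex R d) : R :=
  \big[Num.max/0]_(p : 'I_d.+1 * 'I_d.+1)
    euclidean_norm (vertex S p.1 - vertex S p.2).

(* The interiors of nondegenerate simplices are nonempty, so [cells_disjoint]
   makes the cells pairwise distinct as sets. *)
Record simplicial_partition (R : realType) (d : nat) (Omega : set 'rV[R]_d) :=
  SimplicialPartition {
    ncells : nat;
    cell : 'I_ncells -> simplex R d;
    cells_cover : \bigcup_i body (cell i) = Omega;
    cells_disjoint : forall i j, i != j ->
      (body (cell i))° `&` (body (cell j))° = set0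
  }.

Arguments ncells {R d Omega}.
Arguments cell {R d Omega}.

(* Main.v *)
Require Import Defs.
From mathcomp Require Import all_boot all_order all_algebra.
From mathcomp Require Import all_classical all_reals all_analysis.
From mathcomp Require Import measurable_realfun ring.
Import Order.TTheory GRing.Theory Num.Theory.
Import numFieldNormedType.Exports.
Local Open Scope classical_set_scope.
Local Open Scope ring_scope.

(** Why the theorem holds. Let [S] range over the cells that contain [gamma0],
    and let [h] be the longest edge of [S]. Since [S] contains [gamma0], its
    translated and rescaled copy [(S - gamma0) / h] lies in the Euclidean unit
    ball: no two points of a simplex are further apart than its longest edge
    ([body_dist_le]). The hypothesis says exactly that this copy has volume at
    least [eta]. Copies of different cells do not overlap, because cells are
    convex: a small enough homothety about [gamma0] maps a common point into
    both of the original simplices, whose interiors are disjoint. Hence the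
    number of cells times [eta] is at most the volume of the unit ball.

    The boundary of a cell is a nuisance: disjointness is known for interiors
    only. Rather than proving that boundaries are null sets, each cell is first
    contracted by a factor [t < 1] towards its barycenter, which puts it inside
    its own interior and costs a factor [t ^ d] of volume ([blowup]); at the end
    [t] tends to [1]. Everything about simplices is read off from barycentric
    coordinates: a closed simplex is where they are nonnegative, they are
    positive only at interior points, and they are affine functions.

    The volume of the unit ball is bounded by a Chernoff argument: with [f] the
    density of the centred Gaussian of variance [1/d] in each coordinate, the
    constant [(2 e pi / d) ^ (d/2)] times [f] equals
    [exp (d/2 * (1 - |x|^2))], which is at least [1] on the ball, while [f] has
    integral [1] ([lebesgue_tuple_unit_ball_le]). *)

(** * Affine maps and product densities for Lebesgue measure *)

Section Measure.
Context {R : realType}.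
Local Notation RT := (measurableTypeR R).

(** Both sides are measures of [A], so it is enough to compare them on
    half-open intervals. *)
Lemma lebesgue_measure_affine (a b : R) (A : set RT) : 0 < a -> measurable A ->
  (a%:E * lebesgue_measure [set x : RT | A (a * x + b)%R] =
   lebesgue_measure A)%E.
Proof.
move=> a0 mA.
pose f : RT -> RT := fun x => a * x + b.
have mf : measurable_fun [set: RT] f.
  by apply: measurable_funD => //; exact: measurable_funM.
pose m := mscale (NngNum (ltW a0))
  (measure_function_pushforward__canonical__measure_function_Measure
     lebesgue_measure mf).
suff : lebesgue_measure A = m A by move=> ->.
apply: lebesgue_measure_unique => // _ [[u v]] _ <-.
rewrite /m/= /mscale/= /pushforward/=.
have -> : f @^-1` `]u, v]%classic = `](u - b) / a, (v - b) / a]%classic.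
  apply/seteqP; split=> x /=; rewrite !in_itv/= /f.
    by rewrite ltr_pdivrMr// ler_pdivlMr// ltrBlDr lerBrDr mulrC.
  by rewrite ltr_pdivrMr// ler_pdivlMr// ltrBlDr lerBrDr mulrC.
rewrite !lebesgue_measure_itv/= !lte_fin ltr_pM2r ?invr_gt0// ltrD2r.
case: ifP => _; last by rewrite mule0.
by rewrite -!EFinB -EFinM -mulrBl mulrCA divff ?gt_eqF// mulr1 opprB addrA subrK.
Qed.

Definition affine_tuple n (a : R) (b : 'I_n -> R) (t : n.-tuple RT) :
    n.-tuple RT :=
  [tuple a * tnth t i + b i | i < n].

Lemma measurable_affine_tuple n a b :
  measurable_fun [set: n.-tuple RT] (@affine_tuple n a b).
Proof.
apply/measurable_fun_tnthP => i.
rewrite (_ : _ \o _ = fun t : n.-tuple RT => a * tnth t i + b i); last first.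
  by apply/funext => t /=; rewrite tnth_mktuple.
apply: measurable_funD => //; apply: measurable_funM => //.
exact: measurable_tnth.
Qed.

(** Induction on [n]: the two sides are measures that agree on products of
    measurable sets, and a product measure is determined by these. *)
Lemma lebesgue_tuple_affine n (a : R) (b : 'I_n -> R) (A : set (n.-tuple RT)) :
  0 < a -> measurable A ->
  ((a ^+ n)%:E * lebesgue_tuple n (affine_tuple n a b @^-1` A) =
   lebesgue_tuple n A)%E.
Proof.
move=> a0; elim: n b A => [|n IH] b A mA.
  rewrite expr0 mul1e; congr (lebesgue_tuple 0 _).
  by apply/seteqP; split => t /=; rewrite (tuple0 t) (tuple0 (affine_tuple _ _ _ _)).
pose f (p : RT * n.-tuple RT) : RT * n.-tuple RT :=
  (a * p.1 + b ord0, affine_tuple n a (b \o lift ord0) p.2).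
have mf1 : measurable_fun [set: RT] (fun x : RT => a * x + b ord0 : RT).
  by apply: measurable_funD => //; exact: measurable_funM.
have mf : measurable_fun setT f.
  apply/measurable_fun_pairP; split => /=; first exact: measurableT_comp mf1 _.
  exact: (measurableT_comp (measurable_affine_tuple n a (b \o lift ord0))).
have an0 : 0 <= a ^+ n.+1 by rewrite exprn_ge0 ?ltW.
pose m := mscale (NngNum an0)
  (measure_function_pushforward__canonical__measure_function_Measure
     (lebesgue_measure \x lebesgue_tuple n)%E mf).
rewrite /= /lebesgue_step /pushforward.
rewrite [RHS](@product_measure_unique _ _ _ _ _ _ _ m); first last.
- by rewrite -[X in measurable X]setTI; exact: measurable_consT.
- move=> X Y mX mY; rewrite /m/= /mscale/= /pushforward/=.
  rewrite (_ : _ @^-1` _ = [set x : RT | X (a * x + b ord0)] `*`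
      (affine_tuple n a (b \o lift ord0) @^-1` Y))//.
  rewrite product_measure1E; first last.
  + by rewrite -[X in measurable X]setTI; apply: measurable_affine_tuple.
  + rewrite -[X in measurable X]setTI.
    exact: (mf1 measurableT).
  by rewrite exprS EFinM muleACA lebesgue_measure_affine// IH.
rewrite /m/= /mscale/= /pushforward/=; congr (_ * (_ \x _) _)%E.
apply/seteqP; rewrite /preimage/=.
have E p : affine_tuple n.+1 a b (consT p) = consT (f p).
  apply: eq_from_tnth => i; rewrite tnth_mktuple.
  have [j ->|->] := unliftP ord0 i; last by rewrite !tnth0.
  by rewrite !tnthS tnth_mktuple.
by split=> p /=; rewrite E.
Qed.

(** Tonelli, one coordinate at a time. *)
Lemma integral_lebesgue_tuple_prod n (f : RT -> R) :
  measurable_fun setT f -> (forall x, 0 <= f x) ->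
  (\int[lebesgue_measure]_x (f x)%:E = 1)%E ->
  (\int[lebesgue_tuple n]_t (\prod_(i < n) f (tnth t i))%:E = 1)%E.
Proof.
move=> mf f0 f1.
have mprod m : measurable_fun setT
    (fun t : m.-tuple RT => (\prod_(i < m) f (tnth t i))%:E).
  apply/measurable_EFinP; apply: measurable_prod => i _.
  by apply: measurableT_comp => //; exact: measurable_tnth.
have prod0 m (t : m.-tuple RT) : (0 <= (\prod_(i < m) f (tnth t i))%:E)%E.
  by rewrite lee_fin prodr_ge0.
elim: n => [|n IH].
  rewrite [LHS]integral_dirac//; last exact: mprod.
  by rewrite big_ord0 diracT mul1e.
have -> := ge0_integral_pushforward (@measurable_consT R n)
  (lebesgue_measure \x lebesgue_tuple n)%E measurableT (mprod n.+1); last first.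
  by move=> t _; exact: prod0.
rewrite preimage_setT fubini_tonelli1; first last.
- by move=> p; exact: prod0.
- exact: (measurableT_comp (mprod n.+1) (@measurable_consT R n)).
rewrite /fubini_F/= -[RHS]f1; apply: eq_integral => x _.
under eq_integral => t _.
  rewrite big_ord_recl tnth0; under eq_bigr do rewrite tnthS.
  rewrite EFinM; over.
rewrite /= ge0_integralZl ?IH ?mule1 ?lee_fin//.
- exact: mprod.
- by move=> t _; exact: prod0.
Qed.

End Measure.

(** * The volume of the Euclidean unit ball *)

Section Ball.
Context {R : realType}.
Local Notation RT := (measurableTypeR R).

(** The variance [1/d] is the optimal one for the Chernoff bound below: among
    all [s > 0], the bound [exp s * (pi / s) ^ (d/2)] on the volume of the unit
    ball is smallest at [s = d/2]. *)
Definition gaussian (d : nat) : RT -> R := normal_pdf 0 (Num.sqrt d%:R)^-1.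

Lemma prod_gaussianE (d : nat) (t : d.-tuple RT) : (0 < d)%N ->
  (2 * expR 1 * pi / d%:R) `^ (d%:R / 2) * \prod_(i < d) gaussian d (tnth t i) =
  expR (d%:R / 2 * (1 - \sum_(i < d) (tnth t i : R) ^+ 2)).
Proof.
move=> d0; have dR : 0 < d%:R :> R by rewrite ltr0n.
have s0 : (Num.sqrt d%:R : R)^-1 != 0 by rewrite invr_eq0 gt_eqF// sqrtr_gt0.
have sE : (Num.sqrt d%:R : R)^-1 ^+ 2 = d%:R^-1.
  by rewrite exprVn sqr_sqrtr ?ler0n.
have pE : \prod_(i < d) gaussian d (tnth t i) =
    (2 * pi / d%:R) `^ (- (d%:R / 2)) *
    expR (- (d%:R / 2) * \sum_(i < d) (tnth t i : R) ^+ 2).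
  rewrite /gaussian normal_pdfE// big_split/= prodr_const card_ord.
  congr (_ * _).
    rewrite /normal_peak sE powRN.
    rewrite (_ : d%:R^-1 * pi *+ 2 = 2 * pi / d%:R :> R); last first.
      by field; rewrite gt_eqF.
    rewrite exprVn; congr (_^-1).
    rewrite -powR12_sqrt ?divr_ge0 ?mulr_ge0 ?pi_ge0 ?ler0n//.
    by rewrite -powR_mulrn ?powR_ge0// -powRrM [_^-1 * _]mulrC.
  rewrite -expR_sum mulr_sumr; congr expR; apply: eq_bigr => i _.
  by rewrite sE subr0; field; rewrite gt_eqF.
rewrite pE (_ : 2 * expR 1 * pi / d%:R = expR 1 * (2 * pi / d%:R)); last first.
  by rewrite -!mulrA mulrCA.
have p0 : 0 < 2 * pi / d%:R :> R by rewrite divr_gt0// mulr_gt0// pi_gt0.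
rewrite powRM ?expR_ge0 ?ltW// -expRM mul1r -mulrA (mulrA (_ `^ _)) -powRD; last first.
  by rewrite (gt_eqF p0) implybT.
by rewrite subrr powRr0 mul1r -expRD mulrBr mulr1 mulNr.
Qed.

(** By [prod_gaussianE] the indicator function of the ball is at most the
    constant on the right times a probability density. *)
Lemma lebesgue_tuple_unit_ball_le (d : nat) (A : set (d.-tuple RT)) :
  (0 < d)%N -> measurable A ->
  (forall t, A t -> \sum_(i < d) (tnth t i : R) ^+ 2 <= 1) ->
  (lebesgue_tuple d A <= ((2 * expR 1 * pi / d%:R) `^ (d%:R / 2))%:E)%E.
Proof.
move=> d0 mA A1; set W := _ `^ _.
have mg : measurable_fun [set: RT] (gaussian d) by exact: measurable_normal_pdf.
have g0 x : 0 <= gaussian d x by exact: normal_pdf_ge0.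
have W0 : 0 <= W by exact: powR_ge0.
have mprod : measurable_fun setT
    (fun t : d.-tuple RT => (\prod_(i < d) gaussian d (tnth t i))%:E).
  apply/measurable_EFinP; apply: measurable_prod => i _.
  by apply: measurableT_comp => //; exact: measurable_tnth.
have I1 := integral_lebesgue_tuple_prod d (gaussian d) mg g0
  (integral_normal_pdf _ _).
rewrite -[X in (_ <= X)%E]mule1 -I1 -ge0_integralZl//; last first.
  by move=> t _; rewrite lee_fin prodr_ge0.
have -> : lebesgue_tuple d A = (\int[lebesgue_tuple d]_t (\1_A t)%:E)%E.
  by rewrite integral_indic// setIT.
apply: ge0_le_integral => //.
- by apply/measurable_EFinP; exact: measurable_indic.
- by apply: emeasurable_funM => //; exact: measurable_cst.
move=> t _; rewrite -EFinM lee_fin indicE; case: (boolP (t \in A)); last first.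
  by move=> _; rewrite mulr_ge0 ?prodr_ge0.
rewrite inE => /A1 t1; rewrite prod_gaussianE//.
by rewrite -[leLHS]expR0 ler_expR mulr_ge0 ?subr_ge0.
Qed.

End Ball.

(** * Barycentric coordinates and the diameter of a simplex *)

Section Simplex.
Context {R : realType} {d : nat}.
Implicit Types (S : simplex R d) (x y g : 'rV[R]_d) (j : 'I_d.+1).

Definition edge_mx S : 'M[R]_d :=
  \matrix_(i < d) (vertex S (lift ord0 i) - vertex S ord0).

Definition barycoord S x j : R :=
  let u := (x - vertex S ord0) *m invmx (edge_mx S) in
  if unlift ord0 j is Some k then u 0 k else 1 - \sum_k u 0 k.

Lemma edge_mx_unit S : edge_mx S \in unitmx.
Proof. by rewrite -row_free_unit; exact: vertex_affinely_independent. Qed.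

(** An affine combination of the vertices, written from the base vertex along
    the edges that leave it, so that [edge_mx] can be inverted. *)
Lemma sum_vertexE S (a : 'I_d.+1 -> R) : \sum_j a j = 1 ->
  \sum_j a j *: vertex S j =
  vertex S ord0 + (\row_k a (lift ord0 k)) *m edge_mx S.
Proof.
rewrite !big_ord_recl => /(canRL (addrK _)) ->.
rewrite scalerBl scale1r -addrA; congr (_ + _).
rewrite mulmx_sum_row scaler_suml -sumrN -big_split/=.
apply: eq_bigr => k _; rewrite rowK mxE.
by rewrite scalerBr addrC.
Qed.

Lemma barycoord_comb S (a : 'I_d.+1 -> R) j : \sum_j a j = 1 ->
  barycoord S (\sum_j a j *: vertex S j) j = a j.
Proof.
move=> a1; rewrite /barycoord sum_vertexE// addrC addKr mulmxK ?edge_mx_unit//.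
case: unliftP => [k ->|->]; first by rewrite mxE.
under eq_bigr do rewrite mxE.
by rewrite -a1 big_ord_recl addrK.
Qed.

Lemma sum_barycoord S x : \sum_j barycoord S x j = 1.
Proof.
rewrite big_ord_recl /barycoord unlift_none.
by under [X in _ + X]eq_bigr do rewrite liftK; rewrite subrK.
Qed.

Lemma barycoordK S x : \sum_j barycoord S x j *: vertex S j = x.
Proof.
rewrite sum_vertexE ?sum_barycoord// /barycoord.
rewrite (_ : \row__ _ = (x - vertex S ord0) *m invmx (edge_mx S)); last first.
  by apply/rowP => k; rewrite mxE liftK.
by rewrite mulmxKV ?edge_mx_unit// addrC subrK.
Qed.

(** Expand both points over the vertices: coordinates are unique, by
    [barycoord_comb], so those of the combination can be read off. *)
Lemma barycoord_affine S x y j (p q : R) : p + q = 1 ->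
  barycoord S (p *: x + q *: y) j = p * barycoord S x j + q * barycoord S y j.
Proof.
move=> pq; rewrite -{1}(barycoordK S x) -{1}(barycoordK S y)
  !scaler_sumr -big_split/=.
under eq_bigr do rewrite !scalerA -scalerDl.
by rewrite barycoord_comb// big_split/= -!mulr_sumr !sum_barycoord !mulr1.
Qed.

(** This form makes both the continuity and the Borel measurability of
    barycentric coordinates evident. *)
Lemma barycoord_linear S j : exists (c : R) (u : 'I_d -> R), forall x,
  barycoord S x j = c + \sum_i x 0 i * u i.
Proof.
pose G := invmx (edge_mx S); pose v := vertex S ord0 *m G.
rewrite /barycoord; case: unliftP => [k _|_].
  exists (- v 0 k), (fun i => G i k) => x.
  by rewrite mulmxBl -/v !mxE addrC.
exists (1 + \sum_k v 0 k), (fun i => - \sum_k G i k) => x.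
rewrite -addrA; congr (_ + _).
rewrite mulmxBl -/G -/v; under eq_bigr do rewrite !mxE.
rewrite sumrB opprB; congr (_ + _).
  by apply: eq_bigr => k _; rewrite mxE.
rewrite exchange_big -sumrN; apply: eq_bigr => i _.
by rewrite -mulr_sumr mulrN.
Qed.

Lemma body_barycoordP {S x} : body S x <-> forall j, 0 <= barycoord S x j.
Proof.
split=> [[a [a0 a1 ->]] j|b0]; first by rewrite barycoord_comb.
by exists (barycoord S x); split; rewrite ?sum_barycoord ?barycoordK.
Qed.

Definition open_body S : set 'rV[R]_d := [set x | forall j, 0 < barycoord S x j].

Lemma open_body_open S : open (open_body S).
Proof.
rewrite openE => x x0; pose P j := [set y | 0 < barycoord S y j].
apply: (@filter_forall _ _ P (nbhs x)) => j.
have [c [u bE]] := barycoord_linear S j.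
have cb : continuous (fun y : 'rV[R]_d => barycoord S y j).
  rewrite (_ : (fun y => _) = fun y : 'rV[R]_d => c + \sum_i y 0 i * u i);
    last exact/funext.
  move=> y; apply: (@continuousD R R^o); first exact: cst_continuous.
  move: y; apply: continuous_big; first exact: add_continuous.
  move=> i _ y; apply: (@continuousM R); last exact: cst_continuous.
  exact: coord_continuous.
exact: (cvgr_gt _ (cb x)).
Qed.

Lemma open_body_interior S : open_body S `<=` (body S)°.
Proof.
rewrite -open_subsetE; last exact: open_body_open.
by move=> x x0; apply/body_barycoordP => j; exact: ltW.
Qed.

Definition barycenter S : 'rV[R]_d := \sum_j d.+1%:R^-1 *: vertex S j.

Lemma open_body_contraction S x (t : R) : body S x -> 0 <= t < 1 ->
  open_body S (t *: x + (1 - t) *: barycenter S).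
Proof.
move=> /body_barycoordP x0 /andP[t0 t1] j.
rewrite barycoord_affine ?subrKC//.
rewrite ltr_wpDl ?mulr_ge0// mulr_gt0 ?subr_gt0//.
by rewrite barycoord_comb ?invr_gt0// sumr_const card_ord -[LHS]mulr_natr mulVf//.
Qed.

Lemma open_body_homothety S g x (p : R) :
  body S g -> open_body S x -> 0 < p <= 1 ->
  open_body S (p *: x + (1 - p) *: g).
Proof.
move=> /body_barycoordP g0 x0 /andP[p0 p1] j.
by rewrite barycoord_affine ?subrKC// ltr_pwDl ?mulr_gt0 ?mulr_ge0 ?subr_ge0.
Qed.

(** Jensen's inequality for the square: the difference of the two sides is the
    variance of [z] under the weights [w]. *)
Lemma sqr_convex_comb_le (I : finType) (w z : I -> R) : (forall i, 0 <= w i) ->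
  \sum_i w i = 1 -> (\sum_i w i * z i) ^+ 2 <= \sum_i w i * z i ^+ 2.
Proof.
move=> w0 w1; rewrite -subr_ge0.
set m := \sum_i w i * z i.
rewrite (_ : _ - _ = \sum_i w i * (z i - m) ^+ 2).
  by apply: sumr_ge0 => i _; rewrite mulr_ge0 ?sqr_ge0.
under [RHS]eq_bigr => i _.
  rewrite (_ : _ * _ = w i * z i ^+ 2 - w i * z i * (2 * m) + w i * m ^+ 2);
    last by ring.
  over.
rewrite big_split/= sumrB -!mulr_suml w1 -/m; ring.
Qed.

Lemma vertex_dist_le S i j :
  \sum_k (vertex S i - vertex S j) 0 k ^+ 2 <= longest_edge S ^+ 2.
Proof.
have -> : \sum_k (vertex S i - vertex S j) 0 k ^+ 2 =
    euclidean_norm (vertex S i - vertex S j) ^+ 2.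
  by rewrite sqr_sqrtr// sumr_ge0// => k _; exact: sqr_ge0.
rewrite ler_sqr ?nnegrE ?sqrtr_ge0//; last first.
  exact: bigmax_ge_id.
exact: (le_bigmax _ (fun p => euclidean_norm (vertex S p.1 - vertex S p.2)) (i, j)).
Qed.

(** The difference of two points of a simplex is a convex combination of the
    differences of its vertices, and the squared norm is convex. *)
Lemma body_dist_le S x y : body S x -> body S y ->
  \sum_k (x - y) 0 k ^+ 2 <= longest_edge S ^+ 2.
Proof.
move=> [a [a0 a1 ->]] [b [b0 b1 ->]].
pose w (p : 'I_d.+1 * 'I_d.+1) := a p.1 * b p.2.
have w0 p : 0 <= w p by rewrite mulr_ge0.
have w1 : \sum_p w p = 1.
  by rewrite -(pair_bigA _ (fun i j => a i * b j))/= -big_distrlr/= a1 b1 mulr1.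
pose z (p : 'I_d.+1 * 'I_d.+1) := vertex S p.1 - vertex S p.2.
have zE : \sum_i a i *: vertex S i - \sum_j b j *: vertex S j = \sum_p w p *: z p.
  transitivity (\sum_i \sum_j (a i * b j) *: (vertex S i - vertex S j)); last first.
    by rewrite pair_bigA.
  under [RHS]eq_bigr => i _.
    under eq_bigr do rewrite scalerBr.
    rewrite sumrB -scaler_suml -mulr_sumr b1 mulr1; over.
  rewrite sumrB; congr (_ - _); rewrite exchange_big/=.
  by apply: eq_bigr => j _; rewrite -scaler_suml -mulr_suml a1 mul1r.
rewrite zE.
apply: (@le_trans _ _ (\sum_k \sum_p w p * z p 0 k ^+ 2)).
  apply: ler_sum => k _; rewrite summxE.
  by under eq_bigr do rewrite mxE; exact: sqr_convex_comb_le.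
rewrite exchange_big/= -[leRHS]mul1r -w1 mulr_suml.
apply: ler_sum => p _; rewrite -mulr_sumr ler_wpM2l//; exact: vertex_dist_le.
Qed.

(** Otherwise two vertices coincide, although their barycentric coordinates
    differ. *)
Lemma longest_edge_gt0 S : (0 < d)%N -> 0 < longest_edge S.
Proof.
move=> d0; pose o : 'I_d.+1 := lift ord0 (Ordinal d0).
rewrite lt_neqAle eq_sym bigmax_ge_id andbT; apply/negP => /eqP h0.
have := vertex_dist_le S ord0 o; rewrite h0 expr0n/= => le0.
have vE : vertex S ord0 = vertex S o.
  apply/eqP; rewrite -subr_eq0; apply/eqP/rowP => k; rewrite [RHS]mxE.
  apply/eqP; rewrite -sqrf_eq0 eq_le sqr_ge0 andbT (le_trans _ le0)//.
  by rewrite (bigD1 k)//= lerDl sumr_ge0// => i _; exact: sqr_ge0.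
have vc (i : 'I_d.+1) : \sum_j (i == j)%:R *: vertex S j = vertex S i.
  rewrite (bigD1 i)//= eqxx scale1r big1 ?addr0// => j /negPf.
  by rewrite eq_sym => ->; rewrite scale0r.
have v1 (i : 'I_d.+1) : \sum_j (i == j)%:R = 1 :> R.
  by rewrite (bigD1 i)//= eqxx big1 ?addr0// => j /negPf; rewrite eq_sym => ->.
have := barycoord_comb S _ ord0 (v1 ord0); rewrite vc vE -(vc o) barycoord_comb//.
by move=> /eqP; rewrite eqxx/= eq_sym oner_eq0.
Qed.

End Simplex.

(** * Cells rescaled about a common point *)

Section Cell.
Context {R : realType} {d : nat}.
Local Notation RT := (measurableTypeR R).
Local Notation rowt := (fun z : d.-tuple RT => \row_i (tnth z i : R)).
Implicit Types (S : simplex R d) (g : 'rV[R]_d) (t : R).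

Lemma measurable_body S : measurable [set z : d.-tuple RT | body S (rowt z)].
Proof.
have -> : [set z : d.-tuple RT | body S (rowt z)] =
    \bigcap_(j in [set: 'I_d.+1])
      ([set: d.-tuple RT] `&` [set z | 0 <= barycoord S (rowt z) j]).
  apply/seteqP; split=> z /=.
    by move=> /body_barycoordP b0 j _; split=> //; exact: b0.
  by move=> b0; apply/body_barycoordP => j; have [] := b0 j I.
apply: fin_bigcap_measurable => // j _.
apply: measurable_fun_le => //.
have [c [u bE]] := barycoord_linear S j.
rewrite (_ : (fun z => _) = (fun z => c + \sum_i (tnth z i : R) * u i)); last first.
  by apply/funext => z; rewrite bE; under eq_bigr do rewrite mxE.
apply: measurable_funD => //; apply: measurable_sum => i.
by apply: measurable_funM => //; exact: measurable_tnth.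
Qed.

(** The points [z] such that [g + h z] lies in the contraction of [S] by the
    factor [t] towards its barycenter [c], where [h] is the longest edge: solving
    [g + h z = t y + (1 - t) c] for [y] gives the affine map below. *)
Definition blowup S g t : set (d.-tuple RT) :=
  affine_tuple d (longest_edge S / t)
    (fun i => barycenter S 0 i + (g 0 i - barycenter S 0 i) / t)
  @^-1` [set z | body S (rowt z)].

Lemma measurable_blowup S g t : measurable (blowup S g t).
Proof.
rewrite -[X in measurable X]setTI.
apply: measurable_affine_tuple => //; exact: measurable_body.
Qed.

Lemma blowup_open_body S g t z : (0 < d)%N -> 0 < t < 1 -> blowup S g t z ->
  open_body S (longest_edge S *: rowt z + g).
Proof.
move=> d0 /andP[t0 t1] Kz; set h := longest_edge S; set c := barycenter S.
pose y : 'rV[R]_d := \row_i (tnth (affine_tuple d (h / t)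
  (fun i => c 0 i + (g 0 i - c 0 i) / t) z) i : R).
have Sy : body S y by [].
rewrite (_ : _ + _ = t *: y + (1 - t) *: c); last first.
  apply/rowP => i; rewrite !mxE tnth_mktuple.
  by field; rewrite gt_eqF.
by apply: open_body_contraction => //; rewrite ltW.
Qed.

(** The affine map that defines [blowup] has ratio [h / t], so the volume of
    [S] is divided by [(h / t) ^ d]. *)
Lemma lebesgue_blowup_ge S g t (eta : R) : (0 < d)%N -> 0 < t < 1 ->
  ((eta * longest_edge S ^+ d)%:E <= volume (body S))%E ->
  ((eta * t ^+ d)%:E <= lebesgue_tuple d (blowup S g t))%E.
Proof.
move=> d0 /andP[t0 t1].
have h0 := longest_edge_gt0 S d0; set h := longest_edge S in h0 *.
rewrite /volume -(@lebesgue_tuple_affine _ _ (h / t)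
  (fun i => barycenter S 0 i + (g 0 i - barycenter S 0 i) / t)); last 2 first.
- by rewrite divr_gt0.
- exact: measurable_body.
have th0 : (0 <= ((t / h) ^+ d)%:E)%E by rewrite lee_fin exprn_ge0 ?divr_ge0 ?ltW.
move=> /(lee_wpmul2l th0); rewrite muleA -!EFinM.
have -> : (t / h) ^+ d * (h / t) ^+ d = 1.
  by rewrite -exprMn mulf_div [t * h]mulrC divff ?expr1n// mulf_neq0// gt_eqF.
rewrite mul1e.
apply: le_trans; rewrite lee_fin.
by rewrite mulrCA -exprMn divfK ?gt_eqF.
Qed.

Lemma blowup_norm S g t z : (0 < d)%N -> 0 < t < 1 -> body S g ->
  blowup S g t z -> \sum_(i < d) (tnth z i : R) ^+ 2 <= 1.
Proof.
move=> d0 t01 Sg /(blowup_open_body _ _ _ _ d0 t01).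
move=> /open_body_interior/interior_subset Sz.
have h0 := longest_edge_gt0 S d0.
have := body_dist_le _ _ _ Sz Sg; rewrite addrK.
under eq_bigr do rewrite !mxE exprMn.
by rewrite -mulr_sumr -[leRHS]mulr1 ler_pM2l// exprn_gt0.
Qed.

(** If [z] is in both sets, then [g + h1 z] and [g + h2 z] are interior points of
    the first and of the second simplex. Both lie on the ray from [g] in the
    direction [z], and moving towards [g] stays in the interior, so the nearer of
    the two is interior to both simplices. *)
Lemma blowup_disjoint S1 S2 g t : (0 < d)%N -> 0 < t < 1 ->
  body S1 g -> body S2 g -> (body S1)° `&` (body S2)° = set0 ->
  blowup S1 g t `&` blowup S2 g t = set0.
Proof.
move=> d0 t01 S1g S2g S12; rewrite -subset0 => z [K1 K2].
have h1 := longest_edge_gt0 S1 d0; have h2 := longest_edge_gt0 S2 d0.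
pose e := Num.min (longest_edge S1) (longest_edge S2).
have e0 : 0 < e by rewrite lt_min h1.
have small S : 0 < longest_edge S -> e <= longest_edge S -> body S g ->
    blowup S g t z -> (body S)° (e *: rowt z + g).
  move=> h0 eh Sg /(blowup_open_body _ _ _ _ d0 t01) Iz; apply: open_body_interior.
  rewrite (_ : _ + _ = (e / longest_edge S) *: (longest_edge S *: rowt z + g)
      + (1 - e / longest_edge S) *: g); last first.
    by apply/rowP => i; rewrite !mxE; field; rewrite gt_eqF.
  by apply: open_body_homothety; rewrite // divr_gt0//= ler_pdivrMr// mul1r.
suff : ((body S1)° `&` (body S2)°) (e *: rowt z + g) by rewrite S12.
by split; apply: small; rewrite // ge_min lexx ?orbT.
Qed.

End Cell.

Theorem theorem1 (R : realType) (d : nat) (hd : (2 <= d)%N)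
    (Omega : set 'rV[R]_d)
    (T : nat -> simplicial_partition Omega)
    (eta : R) (heta : 0 < eta)
    (hvol : forall (k : nat) (i : 'I_(ncells (T k))),
       ((eta * longest_edge (cell (T k) i) ^+ d)%:E
          <= volume (body (cell (T k) i)))%E)
    (gamma0 : 'rV[R]_d) (hgamma0 : Omega gamma0) (k : nat) :
  #|[pred i : 'I_(ncells (T k)) | gamma0 \in body (cell (T k) i)]|%:R
    <= eta^-1 * (2 * expR 1 * pi / d%:R) `^ (d%:R / 2).
Proof.
have d0 : (0 < d)%N by exact: ltnW.
set W := _ `^ _; set P := [pred i | _].
pose K t i := blowup (cell (T k) i) gamma0 t.
have PK i : P i -> body (cell (T k) i) gamma0 by rewrite inE.
have bound t : 0 < t < 1 -> #|P|%:R * eta * t ^+ d <= W.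
  move=> t01; rewrite -lee_fin.
  have mK i : measurable (K t i) by exact: measurable_blowup.
  have tK : trivIset [set` P] (K t).
    apply/trivIsetP => i j /PK Pi /PK Pj ij.
    apply: blowup_disjoint => //; exact: cells_disjoint.
  apply: (@le_trans _ _ (lebesgue_tuple d (\big[setU/set0]_(i in P) K t i))).
    rewrite measure_bigsetU_ord_cond//=.
    rewrite (_ : (_ * _)%:E = (\sum_(i in P) (eta * t ^+ d)%:E)%E); last first.
      by rewrite sumEFin sumr_const -mulrA mulr_natl.
    by apply: lee_sum => i _; exact: lebesgue_blowup_ge.
  apply: lebesgue_tuple_unit_ball_le => //.
    exact: bigsetU_measurable.
  move=> z; rewrite -bigcup_pred => -[i /PK Pi Kz].
  exact: (blowup_norm _ _ _ _ d0 t01 Pi Kz).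
rewrite ler_pdivlMl// mulrC.
suff cN : #|P|%:R * eta * t ^+ d @[t --> (1 : R)^'-] --> #|P|%:R * eta.
  apply: (cvgr_to_le cN); near=> t; apply: bound; apply/andP; split; near: t.
    exact: nbhs_left_gt.
  exact: nbhs_left_lt.
have t1 : t ^+ d @[t --> (1 : R)^'-] --> (1 : R) ^+ d.
  by apply: cvg_at_left_filter; exact: exprn_continuous.
have := cvgM (cvg_cst (#|P|%:R * eta)) t1.
by rewrite expr1n mulr1; apply.
Unshelve. all: by end_near. Qed.
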